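(* Let $M\subset\bigoplus_{i=1}^r A[-\delta_i]$ be a graded right $A$-submodule and $\bar M=H(M)\subset\bigoplus_i\bar A[-\delta'_i]$ its component homogenization (with $\delta_i\ge\delta'_i\ge0$). Let $\{g_j\}$ be a set of homogeneous elements of $M$ and $g'_j=\eta(g_j)$. Then $\{g_j\}$ is a basis (resp. minimal basis) of $M$ if and only if $\{g'_j\}$ is a basis (resp. minimal basis) of $\bar M$. In particular $b_d(M)=b_d(\bar M)$ for all $d\ge0$.
   Context: Let $\mathbb K$ be a field, $F=\mathbb K\langle x_1,\dots,x_n\rangle$ the free associative algebra with standard grading, $I\subset F$ a graded two-sided ideal, $A=F/I$. $A[-\delta]$ is $A$ with grading $A[-\delta]_d=A_{d-\delta}$; $\bigoplus_{i=1}^r A[-\delta_i]$ is the graded free right $A$-module with basis $e_i$ of degree $\delta_i$. A basis of a graded submodule means a generating set of homogeneous elements; it is minimal if no element lies in the submodule generated by the others. $b_d(M)$ (graded Betti number) is the number of elements of degree $d$ in a minimal homogeneous basis of $M$ (the same notions are used for $\bar A$-modules). Let $t$ be a new variable, $\bar F=\mathbb K\langle x_1,\dots,x_n,t\rangle$, $\bar I$ the two-sided ideal of $\bar F$ generated by $I$, $\bar A=\bar F/\bar I\supset A$. For integers $\delta_i\ge\delta'_i\ge0$, $\bigoplus_i\bar A[-\delta'_i]$ has basis $\bar e_i$ of degree $\delta'_i$, and $\eta:\bigoplus_iA[-\delta_i]\to\bigoplus_i\bar A[-\delta'_i]$ is the injective graded right $A$-module map $e_i\mapsto\bar e_it^{\delta_i-\delta'_i}$.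 $H(M)$ is the right $\bar A$-submodule generated by $\eta(M)$. *)

(* Defs.v *)
(* Noncommutative polynomials K<x_1..x_m> are modelled as
   functions  seq 'I_m -> K  (coefficient of each word) with finite support
   (predicate [ncpoly]); the product is the Cauchy product over factorizations
   of a word. Quotients F/I are handled as setoids: an A-submodule of
   (+)_i A[-delta_i] is represented by its full preimage in F^r
   (which contains I^r). *)
From HB Require Import structures.
From mathcomp Require Import all_boot all_order all_algebra.
Set Implicit Arguments. Unset Strict Implicit. Unset Printing Implicit Defensive.
Import GRing.Theory.
Local Open Scope ring_scope.

Definition ncF (K : fieldType) (m : nat) := seq 'I_m -> K.

Definition ncpoly {K : fieldType} {m : nat} (f : ncF K m) : Prop :=
  exists N : nat, forall w : seq 'I_m, (N <= size w)%N -> f w = 0.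

Definition nc0 {K : fieldType} {m : nat} : ncF K m := fun _ => 0.
Definition ncadd {K : fieldType} {m : nat} (f g : ncF K m) : ncF K m :=
  fun w => f w + g w.
Definition ncmul {K : fieldType} {m : nat} (f g : ncF K m) : ncF K m :=
  fun w => \sum_(k < (size w).+1) f (take k w) * g (drop k w).
Definition nccomp {K : fieldType} {m : nat} (d : nat) (f : ncF K m) : ncF K m :=
  fun w => if size w == d then f w else 0.
Definition ncfeq {K : fieldType} {m : nat} (f g : ncF K m) : Prop :=
  forall w, f w = g w.

Record graded_ideal {K : fieldType} {m : nat} (I : ncF K m -> Prop) : Prop := {
  gi_poly : forall f, I f -> ncpoly f;
  gi_zero : I nc0;
  gi_add : forall f g, I f -> I g -> I (ncadd f g);
  gi_mul : forall a f b, ncpoly a -> ncpoly b -> I f -> I (ncmul (ncmul a f) b);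
  gi_ext : forall f g, ncfeq f g -> I f -> I g;
  gi_graded : forall d f, I f -> I (nccomp d f) }.

Inductive genIdeal {K : fieldType} {m : nat} (S : ncF K m -> Prop) : ncF K m -> Prop :=
  | genI_base f : S f -> genIdeal S f
  | genI_zero : genIdeal S nc0
  | genI_add f g : genIdeal S f -> genIdeal S g -> genIdeal S (ncadd f g)
  | genI_mul a f b : ncpoly a -> ncpoly b -> genIdeal S f ->
                     genIdeal S (ncmul (ncmul a f) b)
  | genI_ext f g : ncfeq f g -> genIdeal S f -> genIdeal S g.

(* elements of F^r (representatives of elements of (+)_i A[-delta_i]) *)
Definition ncvec (K : fieldType) (m r : nat) := 'I_r -> ncF K m.

Definition vfeq {K : fieldType} {m r : nat} (u v : ncvec K m r) : Prop :=
  forall i w, u i w = v i w.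
Definition vadd {K : fieldType} {m r : nat} (u v : ncvec K m r) : ncvec K m r :=
  fun i => ncadd (u i) (v i).
Definition vmulr {K : fieldType} {m r : nat} (v : ncvec K m r) (a : ncF K m)
  : ncvec K m r := fun i => ncmul (v i) a.
Definition vcomp {K : fieldType} {m r : nat} (delta : 'I_r -> nat) (d : nat)
  (v : ncvec K m r) : ncvec K m r :=
  fun i => if (delta i <= d)%N then nccomp (d - delta i) (v i) else nc0.
Definition vhom {K : fieldType} {m r : nat} (delta : 'I_r -> nat) (d : nat)
  (v : ncvec K m r) : Prop :=
  forall i w, v i w <> 0 -> (size w + delta i)%N = d.

(* graded right A-submodule of (+)_i A[-delta_i], A = F/I, given by its
   preimage M in F^r *)
Record graded_submodule {K : fieldType} {m r : nat} (I : ncF K m -> Prop)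
    (delta : 'I_r -> nat) (M : ncvec K m r -> Prop) : Prop := {
  gs_poly : forall v, M v -> forall i, ncpoly (v i);
  gs_ideal : forall z : ncvec K m r, (forall i, I (z i)) -> M z;
  gs_add : forall u v, M u -> M v -> M (vadd u v);
  gs_mul : forall v a, M v -> ncpoly a -> M (vmulr v a);
  gs_ext : forall u v, vfeq u v -> M u -> M v;
  gs_graded : forall d v, M v -> M (vcomp delta d v) }.

(* right (F/I)-submodule generated by the (classes of the) elements of S *)
Definition span {K : fieldType} {m r : nat} (I : ncF K m -> Prop)
  (S : ncvec K m r -> Prop) (v : ncvec K m r) : Prop :=
  exists (N : nat) (u : 'I_N -> ncvec K m r) (a : 'I_N -> ncF K m)
         (z : ncvec K m r),
    (forall k, S (u k) /\ ncpoly (a k)) /\ (forall i, I (z i)) /\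
    forall i w, v i w = z i w + \sum_(k < N) ncmul (u k i) (a k) w.

Definition fam {K : fieldType} {m r : nat} {J : Type} (g : J -> ncvec K m r)
  : ncvec K m r -> Prop := fun v => exists j, vfeq v (g j).
Definition fam_but {K : fieldType} {m r : nat} {J : Type} (g : J -> ncvec K m r)
  (j : J) : ncvec K m r -> Prop := fun v => exists k, k <> j /\ vfeq v (g k).

Definition is_basis {K : fieldType} {m r : nat} {J : Type} (I : ncF K m -> Prop)
  (M : ncvec K m r -> Prop) (g : J -> ncvec K m r) : Prop :=
  forall v, M v <-> span I (fam g) v.
Definition is_min_basis {K : fieldType} {m r : nat} {J : Type}
  (I : ncF K m -> Prop) (M : ncvec K m r -> Prop) (g : J -> ncvec K m r) : Prop :=
  is_basis I M g /\ forall j, ~ span I (fam_but g j) (g j).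

Definition hom_family {K : fieldType} {m r : nat} {J : Type} (delta : 'I_r -> nat)
  (g : J -> ncvec K m r) (deg : J -> nat) : Prop :=
  forall j, vhom delta (deg j) (g j).

(* inclusion F = K<x_0..x_{n-1}> into Fbar = K<x_0..x_{n-1},t>, t = ord_max *)
Definition ncemb {K : fieldType} {m : nat} (f : ncF K m) : ncF K m.+1 :=
  fun w => let w' := pmap (fun x : 'I_m.+1 => (insub (val x) : option 'I_m)) w in
           if size w' == size w then f w' else 0.
Definition tpow {K : fieldType} {m : nat} (k : nat) : ncF K m.+1 :=
  fun w => if w == nseq k ord_max then 1 else 0.

Definition Ibar {K : fieldType} {m : nat} (I : ncF K m -> Prop) : ncF K m.+1 -> Prop :=
  genIdeal (fun f => exists f0, I f0 /\ ncfeq f (ncemb f0)).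

(* etaH : e_i |-> ebar_i t^(delta_i - delta'_i) *)
Definition etaH {K : fieldType} {m r : nat} (delta delta' : 'I_r -> nat)
  (v : ncvec K m r) : ncvec K m.+1 r :=
  fun i => ncmul (tpow (delta i - delta' i)) (ncemb (v i)).

Definition Hmod {K : fieldType} {m r : nat} (I : ncF K m -> Prop)
  (delta delta' : 'I_r -> nat) (M : ncvec K m r -> Prop) : ncvec K m.+1 r -> Prop :=
  span (Ibar I) (fun v => exists u, M u /\ vfeq v (etaH delta delta' u)).

(* Main.v *)
(** Write [eta = etaH delta delta'].  It has a retraction [rho], which keeps in the
    [i]-th component the coefficients of the words [t^(delta i - delta' i) w] with
    [w] free of [t].  The retraction sends [Ibar I] into [I] and, modulo [I], turns
    right multiplication by [b] on the span of the image of [eta] into right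
    multiplication by [b] at [t = 0].  Hence [u] lies in the span of [S] iff [eta u]
    lies in the span of [eta S], which settles bases and minimal bases.  For the
    Betti numbers it remains to compare two minimal homogeneous bases of the same
    module: modulo the submodule generated in degrees below [d], their degree-[d]
    elements are linearly independent over [K] and have the same linear span, and
    there are finitely many of them because there are finitely many words of
    bounded length. *)
Require Import Defs.
From HB Require Import structures.
From mathcomp Require Import all_boot all_order all_algebra.
From mathcomp Require Import zify.
From Stdlib Require Import FunctionalExtensionality ClassicalEpsilon.
Set Implicit Arguments. Unset Strict Implicit. Unset Printing Implicit Defensive.
Import GRing.Theory.
(* [vector.span] would otherwise shadow [Defs.span]. *)
Import Defs.
Local Open Scope ring_scope.

(** * Products and homogeneous components of noncommutative polynomials *)

Section NcPoly.
Variables (K : fieldType) (m : nat).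
Implicit Types (f g h a b : ncF K m) (w : seq 'I_m) (x : 'I_m) (c : K).

Lemma ncF_ext f g : ncfeq f g -> f = g.
Proof. by move=> e; apply: functional_extensionality. Qed.

Definition ncconst c : ncF K m := fun w => if w is [::] then c else 0.

Definition ncsum (N : nat) (F : 'I_N -> ncF K m) : ncF K m :=
  fun w => \sum_k F k w.

(** Left division by a letter: [f] is its constant term plus the sum over [x] of [x] times
    [ncshift x f]. *)
Definition ncshift x f : ncF K m := fun w => f (x :: w).

Lemma ncmul_nil f g : ncmul f g [::] = f [::] * g [::].
Proof. by rewrite /ncmul big_ord_recl big_ord0 addr0. Qed.

Lemma ncmul_cons f g x w :
  ncmul f g (x :: w) = f [::] * g (x :: w) + ncmul (ncshift x f) g w.
Proof. by rewrite /ncmul big_ord_recl. Qed.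

Lemma ncmulDl f g h : ncmul (ncadd f g) h = ncadd (ncmul f h) (ncmul g h).
Proof.
apply: ncF_ext => w; rewrite /ncmul /ncadd -big_split /=.
by apply: eq_bigr => k _; rewrite mulrDl.
Qed.

Lemma ncmulDr f g h : ncmul f (ncadd g h) = ncadd (ncmul f g) (ncmul f h).
Proof.
apply: ncF_ext => w; rewrite /ncmul /ncadd -big_split /=.
by apply: eq_bigr => k _; rewrite mulrDr.
Qed.

Lemma ncmul0l f : ncmul nc0 f = nc0.
Proof. by apply: ncF_ext => w; rewrite /ncmul big1 // => k _; rewrite mul0r. Qed.

Lemma ncadd0l f : ncadd nc0 f = f.
Proof. by apply: ncF_ext => w; rewrite /ncadd add0r. Qed.

Lemma ncmul_constl c f w : ncmul (ncconst c) f w = c * f w.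
Proof.
case: w => [|x w]; first by rewrite ncmul_nil.
rewrite ncmul_cons (_ : ncshift x (ncconst c) = nc0) //.
by rewrite ncmul0l addr0.
Qed.

Lemma ncmul_constr c f w : ncmul f (ncconst c) w = f w * c.
Proof.
elim: w f => [|x w IHw] f; first by rewrite ncmul_nil.
by rewrite ncmul_cons IHw mulr0 add0r.
Qed.

Lemma ncmul1l f : ncmul (ncconst 1) f = f.
Proof. by apply: ncF_ext => w; rewrite ncmul_constl mul1r. Qed.

Lemma ncmul1r f : ncmul f (ncconst 1) = f.
Proof. by apply: ncF_ext => w; rewrite ncmul_constr mulr1. Qed.

Lemma ncshift_mul x f g :
  ncshift x (ncmul f g) =
  ncadd (ncmul (ncconst (f [::])) (ncshift x g)) (ncmul (ncshift x f) g).
Proof. by apply: ncF_ext => w; rewrite /ncadd ncmul_constl -ncmul_cons. Qed.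

Lemma ncmulZl c f g w :
  ncmul (ncmul (ncconst c) f) g w = c * ncmul f g w.
Proof.
rewrite /ncmul mulr_sumr; apply: eq_bigr => k _.
by rewrite [X in X * _]ncmul_constl mulrA.
Qed.

(** Induction on the word: [ncshift_mul] is a Leibniz rule in which one term keeps only the constant
    of [f], so the induction hypothesis is needed at [ncshift x f] alone. *)
Lemma ncmulA f g h : ncmul f (ncmul g h) = ncmul (ncmul f g) h.
Proof.
apply: ncF_ext => w; elim: w f g h => [|x w IHw] f g h.
  by rewrite !ncmul_nil mulrA.
rewrite !ncmul_cons ncshift_mul ncmulDl /ncadd ncmulZl -IHw ncmul_nil.
by rewrite mulrDr !mulrA addrA.
Qed.

Lemma ncmul_suml N (F : 'I_N -> ncF K m) f :
  ncmul (ncsum F) f = ncsum (fun k => ncmul (F k) f).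
Proof.
apply: ncF_ext => w; rewrite /ncmul /ncsum exchange_big /=.
by apply: eq_bigr => k _; rewrite mulr_suml.
Qed.

Lemma ncpoly0 : ncpoly (@nc0 K m).
Proof. by exists 0%N. Qed.

Lemma ncpoly_const c : ncpoly (ncconst c).
Proof. by exists 1%N => -[]. Qed.

Lemma ncpoly_add f g : ncpoly f -> ncpoly g -> ncpoly (ncadd f g).
Proof.
move=> [N1 h1] [N2 h2]; exists (N1 + N2)%N => w hw.
by rewrite /ncadd h1 ?h2 ?addr0 //; lia.
Qed.

Lemma ncpoly_mul f g : ncpoly f -> ncpoly g -> ncpoly (ncmul f g).
Proof.
move=> [N1 h1] [N2 h2]; exists (N1 + N2)%N => w hw.
rewrite /ncmul big1 // => k _; have hk := ltn_ord k.
have [le1|lt1] := leqP N1 k.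
  by rewrite h1 ?mul0r // size_takel; lia.
by rewrite h2 ?mulr0 // size_drop; lia.
Qed.

Lemma ncpoly_comp d f : ncpoly f -> ncpoly (nccomp d f).
Proof. by move=> [N hN]; exists N => w hw; rewrite /nccomp hN // if_same. Qed.

Lemma ncpoly_shift x f : ncpoly f -> ncpoly (ncshift x f).
Proof. by move=> [N hN]; exists N => w hw; rewrite /ncshift hN //= ltnW. Qed.

Lemma nccomp_mul d f g :
  nccomp d (ncmul f g) =
  ncsum (fun k : 'I_d.+1 => ncmul (nccomp k f) (nccomp (d - k) g)).
Proof.
apply: ncF_ext => w; rewrite /nccomp /ncsum /ncmul.
have [<-|ne_wd] := eqVneq (size w) d; last first.
  rewrite big1 // => k _; rewrite big1 // => l _.
  have hk := ltn_ord k; have hl := ltn_ord l.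
  rewrite size_takel // size_drop.
  case: eqP => [lk|_]; last by rewrite mul0r.
  case: eqP => [e|_]; last by rewrite mulr0.
  by move/eqP: ne_wd; lia.
apply: eq_bigr => k _; rewrite (bigD1 k) //= big1 => [|l ne_lk].
  by have hk := ltn_ord k; rewrite size_takel // size_drop !eqxx addr0.
have hl := ltn_ord l; rewrite size_takel //.
by rewrite -[(l == k :> nat)]/(l == k) (negPf ne_lk) mul0r.
Qed.

End NcPoly.
Arguments ncconst {K} m c w.

(** * Graded ideals *)

Section GradedIdeal.
Variables (K : fieldType) (m : nat) (I : ncF K m -> Prop).
Hypothesis idI : graded_ideal I.
Implicit Types (f g a b : ncF K m).

Lemma gi_mulr f b : I f -> ncpoly b -> I (ncmul f b).
Proof.
move=> If pb; rewrite -[f]ncmul1l.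
exact: (gi_mul idI) (ncpoly_const _ _) pb If.
Qed.

Lemma gi_mull a f : ncpoly a -> I f -> I (ncmul a f).
Proof.
move=> pa If; rewrite -[ncmul a f]ncmul1r.
exact: (gi_mul idI) pa (ncpoly_const _ _) If.
Qed.

Lemma gi_const f : I f -> I (ncconst m (f [::])).
Proof.
by move=> If; apply: (gi_ext idI) (gi_graded idI 0 If); case.
Qed.

End GradedIdeal.

(** A component of [a f b] is a finite sum of products of components of [a], [f] and [b]; hence the
    closure under [ncsum] proved first. *)
Lemma genIdeal_graded (K : fieldType) (m : nat) (S : ncF K m -> Prop) :
    (forall f, S f -> ncpoly f) ->
    (forall d f, S f -> S (nccomp d f)) ->
  graded_ideal (genIdeal S).
Proof.
move=> pS gS; pose G := genIdeal S.
have Gsum N (F : 'I_N -> ncF K m) : (forall k, G (F k)) -> G (ncsum F).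
  elim: N F => [|N IHN] F GF.
    by apply: genI_ext (genI_zero _) => w; rewrite /ncsum big_ord0.
  apply: genI_ext (genI_add (GF ord0) (IHN _ (fun k => GF (lift ord0 k)))).
  by move=> w; rewrite /ncsum big_ord_recl.
have Gpoly f : G f -> ncpoly f.
  elim=> {f} [f /pS //| |f g _ pf _ pg|a f b pa pb _ pf|f g e _ pf].
  - exact: ncpoly0.
  - exact: ncpoly_add.
  - by apply: ncpoly_mul => //; apply: ncpoly_mul.
  - by rewrite -(ncF_ext e).
split=> //; try by constructor.
  by move=> f g e Gf; apply: genI_ext e Gf.
move=> d f Gf; elim: Gf d => {f} [f Sf| |f g _ Gf _ Gg|a f b pa pb Gf IH|f g e _ Gf] d.
- by apply: genI_base; apply: gS.
- by apply: genI_ext (genI_zero _) => w; rewrite /nccomp if_same.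
- apply: genI_ext (genI_add (Gf d) (Gg d)) => w.
  by rewrite /ncadd /nccomp; case: ifP => //; rewrite addr0.
- rewrite nccomp_mul; apply: (Gsum) => k; rewrite nccomp_mul ncmul_suml.
  apply: Gsum => l; apply: genI_mul; try exact: ncpoly_comp.
  exact: IH.
- by rewrite -(ncF_ext e).
Qed.

(** * Right submodules and spans *)

Section Span.
Variables (K : fieldType) (m r : nat) (I : ncF K m -> Prop).
Hypothesis idI : graded_ideal I.
Implicit Types (u v z : ncvec K m r) (S Q : ncvec K m r -> Prop).

Lemma ncvec_ext u v : vfeq u v -> u = v.
Proof.
by move=> e; apply: functional_extensionality => i; apply: ncF_ext.
Qed.

Definition vsum (N : nat) (F : 'I_N -> ncvec K m r) : ncvec K m r :=
  fun i w => \sum_k F k i w.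

Lemma vmulr_const c v i w : vmulr v (ncconst m c) i w = v i w * c.
Proof. exact: ncmul_constr. Qed.

(* Preimages in F^r of right submodules of A^r, A = F/I. *)
Record right_submodule Q : Prop := {
  rs_ideal : forall z, (forall i, I (z i)) -> Q z;
  rs_add : forall u v, Q u -> Q v -> Q (vadd u v);
  rs_mul : forall v a, Q v -> ncpoly a -> Q (vmulr v a) }.

Lemma vsum_closed Q N (F : 'I_N -> ncvec K m r) :
    (forall z, (forall i, I (z i)) -> Q z) ->
    (forall u v, Q u -> Q v -> Q (vadd u v)) ->
  (forall k, Q (F k)) -> Q (vsum F).
Proof.
move=> QI Qadd; elim: N F => [|N IHN] F QF.
  apply: QI => i; apply: (gi_ext idI) (gi_zero idI) => w.
  by rewrite /vsum big_ord0.
rewrite (_ : vsum F = vadd (F ord0) (vsum (fun k => F (lift ord0 k)))).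
  by apply: Qadd => //; apply: IHN.
by apply: ncvec_ext => i w; rewrite /vsum big_ord_recl.
Qed.

Lemma span_submodule S : right_submodule (span I S).
Proof.
split=> [z Iz|u v|v b].
- exists 0%N, (fun _ => z), (fun _ => nc0), z; split; first by case.
  by split=> // i w; rewrite big_ord0 addr0.
- move=> [N1 [u1 [a1 [z1 [h1 [I1 e1]]]]]] [N2 [u2 [a2 [z2 [h2 [I2 e2]]]]]].
  exists (N1 + N2)%N,
    (fun k => match split k with inl i => u1 i | inr j => u2 j end),
    (fun k => match split k with inl i => a1 i | inr j => a2 j end), (vadd z1 z2).
  split; first by move=> k; case: (split k).
  split=> [i|i w]; first exact: (gi_add idI).
  rewrite big_split_ord /= /vadd /ncadd e1 e2 addrACA; congr (_ + (_ + _)).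
    by apply: eq_bigr => k _; rewrite (unsplitK (inl k)).
  by apply: eq_bigr => k _; rewrite (unsplitK (inr k)).
- move=> [N [u [a [z [h [Iz e]]]]]] pb.
  exists N, u, (fun k => ncmul (a k) b), (vmulr z b).
  split=> [k|]; first by split; [apply: (h k).1 | apply: ncpoly_mul => //; apply: (h k).2].
  split=> [i|i w]; first exact: gi_mulr.
  have -> : vmulr v b i = ncmul (ncadd (z i) (ncsum (fun k => ncmul (u k i) (a k)))) b.
    by congr (ncmul _ b); apply: ncF_ext => w'; apply: e.
  rewrite ncmulDl ncmul_suml /ncadd /ncsum.
  by congr (_ + _); apply: eq_bigr => k _; rewrite ncmulA.
Qed.

Lemma span_incl S v : S v -> span I S v.
Proof.
move=> Sv; exists 1%N, (fun _ => v), (fun _ => ncconst m 1), (fun _ => nc0).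
split=> [k|]; first by split=> //; apply: ncpoly_const.
split=> [i|i w]; first exact: gi_zero idI.
by rewrite big_ord_recl big_ord0 ncmul1r addr0 add0r.
Qed.

(** Serves as the induction principle for spans, so that their explicit sums seldom need
    unfolding. *)
Lemma span_min Q S :
  right_submodule Q -> (forall v, S v -> Q v) -> forall v, span I S v -> Q v.
Proof.
move=> sQ SQ v [N [u [a [z [h [Iz e]]]]]].
rewrite (_ : v = vadd z (vsum (fun k => vmulr (u k) (a k)))).
  apply: (rs_add sQ); first exact: (rs_ideal sQ).
  apply: (vsum_closed (rs_ideal sQ) (rs_add sQ)) => k.
  by case: (h k) => /SQ Qu pa; apply: (rs_mul sQ).
exact: ncvec_ext.
Qed.

Lemma span_mono S S' :
  (forall v, S v -> S' v) -> forall v, span I S v -> span I S' v.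
Proof.
by move=> SS'; apply: span_min (span_submodule _) _ => v /SS'; apply: span_incl.
Qed.

End Span.

(** * The embedding [ncemb], the substitution [t = 0], coefficients along powers of [t] *)

Section Homogenization.
Variables (K : fieldType) (n : nat).
Implicit Types (f g : ncF K n) (p q : ncF K n.+1).

Let t : 'I_n.+1 := ord_max.

Lemma ncemb_nil f : ncemb f [::] = f [::].
Proof. by []. Qed.

Lemma ncemb_tcons f w : ncemb f (t :: w) = 0.
Proof.
(* [pmap] drops the leading [t], so the filtered word is at most as long as [w], hence shorter than
   [t :: w]. *)
rewrite /ncemb /= insubN ?ltnn //= size_pmap.
have := count_size (isSome \o (fun x : 'I_n.+1 => (insub (val x) : option 'I_n))) w.
by case: eqP => // ->; rewrite ltnn.
Qed.

Lemma ncemb_xcons f y w :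
  ncemb f (lift ord_max y :: w) = ncemb (ncshift y f) w.
Proof.
have e : insub (val (lift ord_max y)) = Some y.
  by rewrite (_ : val _ = val y) ?valK //; apply: lift_max.
by rewrite /ncemb /= e /= eqSS.
Qed.

Lemma ncshift_emb_t f : ncshift t (ncemb f) = nc0.
Proof. by apply: ncF_ext => w; apply: ncemb_tcons. Qed.

Lemma ncshift_emb_x f y :
  ncshift (lift ord_max y) (ncemb f) = ncemb (ncshift y f).
Proof. by apply: ncF_ext => w; apply: ncemb_xcons. Qed.

Lemma ncemb_add f g : ncemb (ncadd f g) = ncadd (ncemb f) (ncemb g).
Proof.
by apply: ncF_ext => w; rewrite /ncemb /ncadd /=; case: ifP => //; rewrite addr0.
Qed.

Lemma ncemb_mul f g : ncemb (ncmul f g) = ncmul (ncemb f) (ncemb g).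
Proof.
apply: ncF_ext => w; elim: w f => [|x w IHw] f; first by rewrite ncemb_nil !ncmul_nil.
case: (unliftP ord_max x) => [y ->|->].
  rewrite ncmul_cons ncshift_emb_x -IHw !ncemb_xcons ncshift_mul ncemb_add.
  rewrite /ncadd; congr (_ + _); rewrite /ncemb /=.
  by case: ifP; rewrite ?mulr0 // ncmul_constl.
by rewrite ncmul_cons ncshift_emb_t ncmul0l !ncemb_tcons mulr0 addr0.
Qed.

Lemma nccomp_emb d f : nccomp d (ncemb f) = ncemb (nccomp d f).
Proof.
apply: ncF_ext => w; rewrite /nccomp /ncemb /=.
by case: (eqVneq (size (pmap _ _))) => [->|_] //; rewrite if_same.
Qed.

Lemma ncpoly_emb f : ncpoly f -> ncpoly (ncemb f).
Proof.
move=> [N hN]; exists N => w hw; rewrite /ncemb /=.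
by case: eqP => // e; rewrite hN // e.
Qed.

(** The substitution [t = 0], a multiplicative retraction of [ncemb]. *)
Definition ncev0 p : ncF K n := fun w => p (map (lift ord_max) w).

Lemma ncev0_mul p q : ncev0 (ncmul p q) = ncmul (ncev0 p) (ncev0 q).
Proof.
apply: ncF_ext => w; elim: w p => [|x w IHw] p; first by rewrite /ncev0 !ncmul_nil.
by rewrite [RHS]ncmul_cons -(IHw (ncshift _ p)) /ncev0 /= ncmul_cons.
Qed.

Lemma ncev0_const c : ncev0 (ncconst n.+1 c) = ncconst n c.
Proof. by apply: ncF_ext => -[]. Qed.

Lemma ncev0_emb f : ncev0 (ncemb f) = f.
Proof.
apply: ncF_ext => w; elim: w f => [//|x w IHw] f.
by rewrite -[RHS](IHw (ncshift x f)) /ncev0 /= ncemb_xcons.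
Qed.

Lemma ncpoly_ev0 p : ncpoly p -> ncpoly (ncev0 p).
Proof. by move=> [N hN]; exists N => w hw; rewrite /ncev0 hN // size_map. Qed.

(* The coefficients of the words [t^e w], [w] a word without [t]. *)
Definition nctcoef e p : ncF K n := ncev0 (iter e (ncshift t) p).

Lemma nctcoefS e p : nctcoef e.+1 p = nctcoef e (ncshift t p).
Proof. by rewrite /nctcoef iterSr. Qed.

Lemma nctcoef_add e p q :
  nctcoef e (ncadd p q) = ncadd (nctcoef e p) (nctcoef e q).
Proof. by elim: e p q => [//|e IHe] p q; rewrite !nctcoefS -IHe. Qed.

Lemma nctcoefZ e c p :
  nctcoef e (ncmul (ncconst n.+1 c) p) = ncmul (ncconst n c) (nctcoef e p).
Proof.
elim: e p => [|e IHe] p; first by rewrite /nctcoef /= ncev0_mul ncev0_const.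
rewrite !nctcoefS -IHe; congr nctcoef; apply: ncF_ext => w.
by rewrite /ncshift !ncmul_constl.
Qed.

(** Recursion for coefficients of a product: the leading [t] falls either to [q], after the constant
    term of [p], or to [p]. *)
Lemma nctcoefS_mul e p q :
  nctcoef e.+1 (ncmul p q) =
  ncadd (ncmul (ncconst n (p [::])) (nctcoef e.+1 q)) (nctcoef e (ncmul (ncshift t p) q)).
Proof. by rewrite !nctcoefS ncshift_mul nctcoef_add nctcoefZ. Qed.

Lemma ncpoly_tcoef e p : ncpoly p -> ncpoly (nctcoef e p).
Proof.
elim: e p => [|e IHe] p pp; first exact: ncpoly_ev0.
by rewrite nctcoefS; apply/IHe/ncpoly_shift.
Qed.

Lemma ncshift_tpow e p : ncshift t (ncmul (tpow e.+1) p) = ncmul (tpow e) p.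
Proof.
rewrite ncshift_mul; apply: ncF_ext => w.
rewrite /ncadd ncmul_constl mul0r add0r; congr (ncmul _ p w).
by apply: ncF_ext => w'; rewrite /ncshift /tpow /= eqseq_cons eqxx.
Qed.

Lemma ncmul_tpow0 p : ncmul (tpow 0) p = p.
Proof. by rewrite -[RHS]ncmul1l; congr ncmul; apply: ncF_ext => -[]. Qed.

Lemma ncpoly_tpow e : ncpoly (@tpow K n e).
Proof.
exists e.+1 => w hw; rewrite /tpow; case: eqP => // ew.
by move: hw; rewrite ew size_nseq ltnn.
Qed.

Lemma nctcoef_tpow e p : nctcoef e (ncmul (tpow e) p) = ncev0 p.
Proof.
elim: e => [|e IHe]; first by rewrite ncmul_tpow0.
by rewrite nctcoefS ncshift_tpow.
Qed.

Lemma nctcoef_tpow_lt k e p : (k < e)%N -> nctcoef k (ncmul (tpow e) p) [::] = 0.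
Proof.
elim: k e => [|k IHk] [|e] // lt_ke; last by rewrite nctcoefS ncshift_tpow IHk.
by rewrite /nctcoef /ncev0 /= ncmul_nil mul0r.
Qed.

Lemma ncmul_tpow_supp e p w : ncmul (tpow e) p w <> 0 ->
  exists2 w', size w = (e + size w')%N & p w' <> 0.
Proof.
elim: e w => [|e IHe] w; first by rewrite ncmul_tpow0; exists w.
case: w => [|x w]; first by rewrite ncmul_nil mul0r.
case: (eqVneq x t) => [->|ne_xt].
  rewrite -/(ncshift t _ w) ncshift_tpow => /IHe[w' e1 e2].
  by exists w' => //=; rewrite e1.
rewrite ncmul_cons mul0r add0r (_ : ncshift x _ = nc0) ?ncmul0l //.
by apply: ncF_ext => w'; rewrite /ncshift /tpow /= eqseq_cons (negPf ne_xt).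
Qed.

(** * Coefficients of elements of [Ibar I] *)

Section Ideal.
Variable I : ncF K n -> Prop.
Hypothesis idI : graded_ideal I.

Lemma Ibar_graded : graded_ideal (Ibar I).
Proof.
apply: genIdeal_graded => [f [f0 [If0 /ncF_ext->]]|d f [f0 [If0 /ncF_ext->]]].
  by apply/ncpoly_emb/(gi_poly idI).
exists (nccomp d f0); split; first exact: (gi_graded idI).
by rewrite nccomp_emb.
Qed.

Lemma Ibar_emb f : I f -> Ibar I (ncemb f).
Proof. by move=> If; apply: genI_base; exists f. Qed.

Lemma Ibar_tcoef p : Ibar I p -> forall e, I (nctcoef e p).
Proof.
elim=> {p} [p [f [If /ncF_ext->]]| |p q _ IHp _ IHq|a p b pa pb _ IHp|p q /ncF_ext-> //] e.
- case: e => [|e]; first by rewrite /nctcoef /= ncev0_emb.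
  rewrite nctcoefS ncshift_emb_t; apply: (gi_ext idI) (gi_zero idI) => w.
  by elim: e => [//|e]; rewrite nctcoefS.
- apply: (gi_ext idI) (gi_zero idI) => w.
  by elim: e => [//|e]; rewrite nctcoefS.
- by rewrite nctcoef_add; apply: (gi_add idI).
(* Left factor first: the induction replaces [a] by its shifts and keeps [p] fixed. For the right
   factor below, it is [p'] that is shifted. *)
- have Iap k : I (nctcoef k (ncmul a p)).
    elim: k a pa => [|k IHk] a' pa'.
      rewrite /nctcoef /= ncev0_mul; apply: gi_mull (IHp 0%N) => //.
      exact: ncpoly_ev0.
    rewrite nctcoefS_mul; apply: (gi_add idI).
      by apply: gi_mull => //; apply: ncpoly_const.
    by apply: IHk; apply: ncpoly_shift.
  elim: e (ncmul a p) Iap => [|e IHe] p' Ip'.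
    rewrite /nctcoef /= ncev0_mul; apply: gi_mulr (Ip' 0%N) _ => //.
    exact: ncpoly_ev0.
  rewrite nctcoefS_mul; apply: (gi_add idI); last first.
    by apply: IHe => k; rewrite -nctcoefS.
  apply: gi_mulr => //; last exact: ncpoly_tcoef.
  (* The constant term of [p'] is that of its coefficient along [t^0], so gradedness puts it in
     [I]. *)
  exact: (gi_const idI (Ip' 0%N)).
Qed.

(** * The map [eta], its retraction and their effect on spans *)

Section Eta.
Variables (r : nat) (delta delta' : 'I_r -> nat).
Implicit Types (u : ncvec K n r) (v : ncvec K n.+1 r) (S : ncvec K n r -> Prop).

Let eta := @etaH K n r delta delta'.

Definition etaimg S v := exists u, S u /\ vfeq v (eta u).

Definition rho v : ncvec K n r := fun i => nctcoef (delta i - delta' i) (v i).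

Lemma rho_eta u : rho (eta u) = u.
Proof.
apply: ncvec_ext => i w.
by rewrite /rho /eta /etaH nctcoef_tpow ncev0_emb.
Qed.

Lemma eta_add u1 u2 : eta (vadd u1 u2) = vadd (eta u1) (eta u2).
Proof.
by apply: ncvec_ext => i w; rewrite /eta /etaH /vadd ncemb_add ncmulDr.
Qed.

Lemma eta_mul u a : eta (vmulr u a) = vmulr (eta u) (ncemb a).
Proof.
by apply: ncvec_ext => i w; rewrite /eta /etaH /vmulr ncemb_mul ncmulA.
Qed.

(** The power of [t] lengthens words by [delta i - delta' i], which compensates the change of
    shift. *)
Lemma eta_hom d u : (forall i, delta' i <= delta i)%N ->
  vhom delta d u -> vhom delta' d (eta u).
Proof.
move=> le_delta hu i w /ncmul_tpow_supp[w' ->].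
rewrite /ncemb /=; case: eqP => // e /hu <-.
by have := le_delta i; lia.
Qed.

(** [eta] is additive and carries [a] to [ncemb a], so the vectors whose image lies in the span form
    a submodule. *)
Lemma span_eta S u : span I S u -> span (Ibar I) (etaimg S) (eta u).
Proof.
have sB := span_submodule Ibar_graded (etaimg S).
move: u; apply: (span_min idI) => [|u Su]; last first.
  by apply: (span_incl Ibar_graded); exists u.
split=> [z Iz|u1 u2 s1 s2|u a su pa].
- apply: (rs_ideal sB) => i; apply: gi_mull; first exact: Ibar_graded.
    exact: ncpoly_tpow.
  exact: Ibar_emb.
- by rewrite eta_add; apply: (rs_add sB).
- by rewrite eta_mul; apply: (rs_mul sB) => //; apply: ncpoly_emb.
Qed.

(* [rho] is not [A]-linear: [rho (v b)] also collects the terms [v(t^k) b(t^(e-k) w)]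
   with [k < e], so one carries along that the constants [v(t^k)] lie in [I]. *)
Lemma span_rho S v : span (Ibar I) (etaimg S) v -> span I S (rho v).
Proof.
have sB := span_submodule idI S.
pose lowI v := forall i k, (k < delta i - delta' i)%N -> I (ncconst n (nctcoef k (v i) [::])).
suff: span (Ibar I) (etaimg S) v -> span I S (rho v) /\ lowI v by move=> h /h[].
move: v; apply: (span_min Ibar_graded) => [|v [u [Su /ncvec_ext->]]]; last first.
  rewrite rho_eta; split; first exact: span_incl.
  move=> i k lt_k; rewrite nctcoef_tpow_lt //.
  by apply: (gi_ext idI) (gi_zero idI) => -[].
split=> [z Iz|v1 v2 [s1 l1] [s2 l2]|v b [sv lv] pb].
- split; first by apply: (rs_ideal sB) => i; apply: Ibar_tcoef.
  by move=> i k _; exact: (gi_const idI (Ibar_tcoef (Iz i) k)).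
- split=> [|i k lt_k].
    rewrite (_ : rho _ = vadd (rho v1) (rho v2)); first exact: (rs_add sB).
    by apply: ncvec_ext => i w; rewrite /rho /vadd nctcoef_add.
  apply: (gi_ext idI) (gi_add idI (l1 i k lt_k) (l2 i k lt_k)) => w.
  by rewrite /vadd nctcoef_add /ncadd; case: w => //=; rewrite addr0.
(* Factorizations of [t^e w] cut before the end of [t^e] contribute constants in [I] times
   coefficients of [b], collected in [z]; the others give the product at [t = 0]. *)
have mulP e (p : ncF K n.+1) :
    (forall k, (k < e)%N -> I (ncconst n (nctcoef k p [::]))) ->
  exists2 z, I z & nctcoef e (ncmul p b) = ncadd z (ncmul (nctcoef e p) (ncev0 b)).
  elim: e p => [|e IHe] p Ip.
    exists nc0; first exact: (gi_zero idI).
    by rewrite ncadd0l /nctcoef /= ncev0_mul.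
  have [k lt_k|z Iz ez] := IHe (ncshift t p); first by rewrite -nctcoefS; apply: Ip.
  exists (ncadd (ncmul (ncconst n (p [::])) (nctcoef e.+1 b)) z).
    apply: (gi_add idI) => //; apply: gi_mulr => //; first exact: (Ip 0%N).
    exact: ncpoly_tcoef.
  rewrite nctcoefS_mul ez !nctcoefS; apply: ncF_ext => w.
  by rewrite /ncadd addrA.
split.
  have [z hz] := fin_all_exists2 (fun i => mulP _ _ (lv i)).
  move=> ez; rewrite (_ : rho _ = vadd z (vmulr (rho v) (ncev0 b))).
    apply: (rs_add sB); first exact: (rs_ideal sB).
    by apply: (rs_mul sB) => //; apply: ncpoly_ev0.
  by apply: ncvec_ext => i w; rewrite /rho {1}/vmulr ez.
(* [mulP] at exponent [k] shows that the constant along [t^k] of the product is, modulo [I], that of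
   [v i] times [b [::]]. *)
move=> i k lt_k; have [l lt_lk|z Iz ez] := mulP k (v i).
  by apply: lv; apply: ltn_trans lt_k.
rewrite /vmulr ez; have := gi_add idI (gi_const idI Iz)
  (gi_mulr idI (lv i k lt_k) (ncpoly_const n (b [::]))).
apply: (gi_ext idI) => w; rewrite /ncadd ncmul_constr.
by case: w => [|x w] /=; rewrite ?ncmul_nil // mul0r addr0.
Qed.

Lemma span_eta_iff S u : span (Ibar I) (etaimg S) (eta u) <-> span I S u.
Proof.
by split=> [/span_rho|/span_eta //]; rewrite rho_eta.
Qed.

Lemma etaimg_fam J (g : J -> ncvec K n r) v :
  etaimg (fam g) v <-> fam (fun j => eta (g j)) v.
Proof.
split=> [[u [[j /ncvec_ext->] ev]]|[j ev]]; first by exists j.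
by exists (g j); split=> //; exists j.
Qed.

Lemma etaimg_fam_but J (g : J -> ncvec K n r) j v :
  etaimg (fam_but g j) v <-> fam_but (fun k => eta (g k)) j v.
Proof.
split=> [[u [[k [ne /ncvec_ext->]] ev]]|[k [ne ev]]]; first by exists k.
by exists (g k); split=> //; exists k.
Qed.

(** * Transfer of bases and minimal bases *)

Section Basis.
Variables (M : ncvec K n r -> Prop) (J : Type) (g : J -> ncvec K n r).
Hypothesis modM : graded_submodule I delta M.
Hypothesis gM : forall j, M (g j).

Lemma is_basis_eta :
  is_basis I M g <-> is_basis (Ibar I) (Hmod I delta delta' M) (fun j => eta (g j)).
Proof.
have idB := Ibar_graded.
split=> [bg v|bg v]; split.
- apply: (span_min idB) => [|_ [u [/bg su /ncvec_ext->]]].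
    exact: span_submodule.
  by apply: (span_mono idB) (span_eta su) => v' /etaimg_fam.
- apply: (span_mono idB) => _ [j /ncvec_ext->].
  by exists (g j).
(* Descent: [eta v] lies in [Hmod], hence in the span of the images of the [g j], and [span_eta_iff]
   pulls this back. *)
- move=> Mv; apply/span_eta_iff.
  apply: (span_mono idB (fun v => (etaimg_fam g v).2)); apply/bg.
  by apply: (span_incl idB); exists v.
- apply: (span_min idI) => [|_ [j /ncvec_ext->] //].
  by case: modM.
Qed.

Lemma is_min_basis_eta :
  is_min_basis I M g <->
  is_min_basis (Ibar I) (Hmod I delta delta' M) (fun j => eta (g j)).
Proof.
have idB := Ibar_graded.
split=> -[bg mg]; (split; first exact/is_basis_eta) => j sj; apply: (mg j).
  apply/span_eta_iff; apply: (span_mono idB) sj => v.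
  by move/etaimg_fam_but.
move/span_eta_iff: sj; apply: (span_mono idB) => v.
by move/etaimg_fam_but.
Qed.

End Basis.
End Eta.
End Ideal.
End Homogenization.

(** * Minimal homogeneous bases in a fixed degree *)

Section HomogeneousBasis.
Variables (K : fieldType) (m r : nat) (I : ncF K m -> Prop) (delta : 'I_r -> nat).
Hypothesis idI : graded_ideal I.
Implicit Types (u v z : ncvec K m r) (M Q : ncvec K m r -> Prop) (J : Type).

Lemma vcompE d v i w :
  vcomp delta d v i w = if (size w + delta i == d)%N then v i w else 0.
Proof.
rewrite /vcomp; case: leqP => h; last by case: eqP => // e; lia.
by rewrite /nccomp; congr (if _ then _ else _); lia.
Qed.

Lemma vcomp_hom d v : vhom delta d v -> vcomp delta d v = v.
Proof.
move=> hv; apply: ncvec_ext => i w; rewrite vcompE; case: eqP => // ne.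
by case: (eqVneq (v i w) 0) => [->|/eqP/hv].
Qed.

Lemma vcomp_mul e d u a : vhom delta e u ->
  vcomp delta d (vmulr u a) =
  if (e <= d)%N then vmulr u (nccomp (d - e) a) else fun _ => nc0.
Proof.
move=> hu; apply: ncvec_ext => i w; rewrite vcompE.
transitivity (\sum_(k < (size w).+1)
    if (size w + delta i == d)%N then u i (take k w) * a (drop k w) else 0).
  by case: ifP => // _; rewrite big1.
transitivity (\sum_(k < (size w).+1)
    if (e <= d)%N then u i (take k w) * nccomp (d - e) a (drop k w) else 0);
  last by case: ifP => // _; rewrite big1.
(* If [u] is nonzero on the prefix, the prefix has degree [e], so the word has degree [d] exactly
   when [e <= d] and the suffix has length [d - e]. *)
apply: eq_bigr => k _; have hk := ltn_ord k.
case: (eqVneq (u i (take k w)) 0) => [->|/eqP/hu]; first by rewrite !mul0r !if_same.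
rewrite size_takel // /nccomp size_drop => ek.
rewrite (_ : (_ == d) = (e <= d)%N && (size w - k == d - e)%N); last by lia.
by case: (e <= d)%N => //=; case: ifP => // _; rewrite mulr0.
Qed.

Definition vlin p (c : 'I_p -> K) (h : 'I_p -> ncvec K m r) : ncvec K m r :=
  vsum (fun k => vmulr (h k) (ncconst m (c k))).

Lemma vlinE p (c : 'I_p -> K) h i w : vlin c h i w = \sum_k h k i w * c k.
Proof. by apply: eq_bigr => k _; rewrite vmulr_const. Qed.

Lemma vlin_closed Q p (c : 'I_p -> K) h :
  right_submodule I Q -> (forall k, Q (h k)) -> Q (vlin c h).
Proof.
move=> sQ Qh; apply: (vsum_closed idI (rs_ideal sQ) (rs_add sQ)) => k.
by apply: (rs_mul sQ) => //; apply: ncpoly_const.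
Qed.

(** As [v] is its own degree-[d] component, coefficients may be replaced by their homogeneous
    components. Only such multiples of generators must satisfy [Q], which may thus be a statement
    about scalar combinations. *)
Lemma hom_span_closed J (g : J -> ncvec K m r) deg Q d v :
    hom_family delta g deg ->
    (forall z, (forall i, I (z i)) -> Q z) ->
    (forall u u', Q u -> Q u' -> Q (vadd u u')) ->
    (forall k a, ncpoly a -> (deg k <= d)%N ->
       Q (vmulr (g k) (nccomp (d - deg k) a))) ->
  vhom delta d v -> span I (fam g) v -> Q v.
Proof.
move=> hg QI Qadd Qg hv [N [u [a [z [hu [Iz e]]]]]].
rewrite -(vcomp_hom hv).
rewrite (_ : vcomp delta d v = vadd (vcomp delta d z)
    (vsum (fun k => vcomp delta d (vmulr (u k) (a k))))); last first.
  apply: ncvec_ext => i w; rewrite /vadd /ncadd /vsum !vcompE e.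
  case: ifP => h; first by congr (_ + _); apply: eq_bigr => k _; rewrite vcompE h.
  by rewrite big1 ?addr0 // => k _; rewrite vcompE h.
have Q0 : Q (fun _ => nc0) by apply: (QI) => i; apply: gi_zero idI.
apply: (Qadd).
  apply: (QI) => i; rewrite /vcomp; case: ifP => _; last exact: gi_zero idI.
  exact: (gi_graded idI).
apply: (vsum_closed idI QI Qadd) => k; case: (hu k) => -[j /ncvec_ext->] pa.
by rewrite (vcomp_mul _ _ (hg j)); case: ifP => // le_d; apply: Qg.
Qed.

(** Depends on [M] alone, so two bases of [M] can be compared modulo it. *)
Definition low M d := span I (fun v => exists2 e, (e < d)%N & M v /\ vhom delta e v).

Lemma low_submodule M d : right_submodule I (low M d).
Proof. exact: span_submodule. Qed.

Section Generators.
Variables (M : ncvec K m r -> Prop) (J : Type) (g : J -> ncvec K m r).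
Variables (deg : J -> nat) (d : nat).
Hypotheses (hg : hom_family delta g deg) (bg : is_basis I M g).

Lemma basis_mem j : M (g j).
Proof. by apply/bg; apply: (span_incl idI); exists j. Qed.

(** For degree reasons, an element of degree below [d] involves only generators of degree below
    [d]. *)
Lemma low_span v :
  low M d v -> span I (fun u => exists2 k, (deg k < d)%N & u = g k) v.
Proof.
have sB := span_submodule idI (fun u => exists2 k, (deg k < d)%N & u = g k).
move: v; apply: (span_min idI sB) => v [e lt_ed [/bg sv hv]].
apply: (hom_span_closed hg (rs_ideal sB) (rs_add sB) _ hv sv) => k a pa le_e.
apply: (rs_mul sB); last exact: ncpoly_comp.
by apply: (span_incl idI); exists k => //; apply: leq_ltn_trans lt_ed.
Qed.

(* Homogeneous elements of degree [d] are, modulo [low M d], scalar combinations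
   of the degree-[d] generators: the coefficients on them have degree 0. *)
Lemma hom_expand q (s : 'I_q -> J) v :
    (forall k, deg k = d -> exists j, s j = k) ->
    M v -> vhom delta d v ->
  exists (c : 'I_q -> K) l, low M d l /\ v = vadd l (vlin c (g \o s)).
Proof.
move=> full /bg sv hv; have sL := low_submodule M d.
pose Q u := exists (c : 'I_q -> K) l, low M d l /\ u = vadd l (vlin c (g \o s)).
apply: (hom_span_closed (Q := Q) hg _ _ _ hv sv) => [z Iz|u u'|k a pa].
- exists (fun _ => 0), z; split; first exact: (rs_ideal sL).
  apply: ncvec_ext => i w; rewrite /vadd /ncadd vlinE big1 ?addr0 // => k _.
  by rewrite mulr0.
- move=> [c1 [l1 [L1 ->]]] [c2 [l2 [L2 ->]]].
  exists (fun k => c1 k + c2 k), (vadd l1 l2); split; first exact: (rs_add sL).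
  apply: ncvec_ext => i w; rewrite /vadd /ncadd !vlinE addrACA -big_split /=.
  by congr (_ + _); apply: eq_bigr => k _; rewrite mulrDr.
rewrite leq_eqVlt => /predU1P[dk|lt_d].
  have [j sj] := full k dk; exists (fun l => if l == j then a [::] else 0), (fun _ => nc0).
  split; first by apply: (rs_ideal sL) => i; apply: gi_zero idI.
  apply: ncvec_ext => i w.
  rewrite /vadd ncadd0l vlinE (bigD1 j) //= big1 => [|l /negPf->]; last by rewrite mulr0.
  rewrite eqxx addr0 sj dk subnn (_ : nccomp 0 a = ncconst m (a [::])).
    by rewrite vmulr_const.
  by apply: ncF_ext => -[].
exists (fun _ => 0), (vmulr (g k) (nccomp (d - deg k) a)); split.
  apply: (rs_mul sL); last exact: ncpoly_comp.
  by apply: (span_incl idI); exists (deg k) => //; split=> //; apply: basis_mem.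
apply: ncvec_ext => i w; rewrite /vadd /ncadd vlinE big1 ?addr0 // => j _.
by rewrite mulr0.
Qed.

End Generators.

(** If [c k] were nonzero, the relation could be solved for [g (s k)], against minimality. *)
Lemma min_basis_indep M J (g : J -> ncvec K m r) deg d p (s : 'I_p -> J) c :
    hom_family delta g deg -> is_min_basis I M g ->
    injective s -> (forall k, deg (s k) = d) ->
  low M d (vlin c (g \o s)) -> forall k, c k = 0.
Proof.
move=> hg [bg mg] inj_s ds lowc k; apply/eqP/contraT => /eqP ck0.
case: (mg (s k)); set B := span _ _.
have sB : right_submodule I B by apply: span_submodule.
(* The generators spanning [low M d] have degree below [d], so [s k] is not among their indices. *)
have lowB v : low M d v -> B v.
  move=> /(low_span hg bg); apply: (span_mono idI) => _ [l lt_l ->].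
  by exists l; split=> // els; move: lt_l; rewrite els ds ltnn.
(* The relation divided by [c k]; the value 0 at [k] leaves [g (s k)] out of the right-hand side. *)
pose c' l := if l == k then 0 else - (c l / c k).
rewrite (_ : g (s k) = vadd (vmulr (vlin c (g \o s)) (ncconst m (c k)^-1)) (vlin c' (g \o s))).
  apply: (rs_add sB).
    by apply: (rs_mul sB); [apply: lowB | apply: ncpoly_const].
  apply: (vsum_closed idI (rs_ideal sB) (rs_add sB)) => l.
  rewrite /c'; case: eqP => [_|ne_lk].
    apply: (rs_ideal sB) => i; apply: (gi_ext idI) (gi_zero idI) => w.
    by rewrite vmulr_const mulr0.
  apply: (rs_mul sB); last exact: ncpoly_const.
  by apply: (span_incl idI); exists (s l); split=> // /inj_s.
apply: ncvec_ext => i w; rewrite /vadd /ncadd vmulr_const !vlinE mulr_suml -big_split /=.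
rewrite (bigD1 k) //= big1 => [|l /negPf ne_lk].
  by rewrite /c' eqxx mulr0 !addr0 -mulrA divff ?mulr1 //; apply/eqP.
by rewrite /c' ne_lk mulrN -mulrA subrr.
Qed.

(** A homogeneous element of degree [d] is supported on words of length at most [d], so independence
    bounds the number of such elements by the number of coefficients. *)
Lemma min_basis_bounded M J (g : J -> ncvec K m r) deg d :
    hom_family delta g deg -> is_min_basis I M g ->
  exists B, forall p (s : 'I_p -> J),
    injective s -> (forall k, deg (s k) = d) -> (p <= B)%N.
Proof.
move=> hg mg; pose T := ('I_r * d.-bseq 'I_m)%type; exists #|{: T}| => p s inj_s ds.
pose G := \matrix_(k < p, x < #|{: T}|)
  let iw : T := enum_val x in g (s k) iw.1 (bseqval iw.2).
suff /eqP <- : row_free G by apply: rank_leq_col.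
apply: inj_row_free => u uG0; apply/rowP => k; rewrite mxE.
apply: (min_basis_indep (c := fun k => u 0 k) hg mg inj_s ds _ k).
apply: (rs_ideal (low_submodule M d)) => i; apply: (gi_ext idI) (gi_zero idI) => w.
rewrite vlinE; have [le_wd|lt_dw] := leqP (size w) d; last first.
  rewrite big1 // => l _ /=; case: (eqVneq (g (s l) i w) 0) => [->|/eqP/hg].
    by rewrite mul0r.
  by rewrite ds; lia.
pose wd : T := (i, Bseq le_wd).
have /matrixP/(_ 0 (enum_rank wd)) := uG0; rewrite !mxE => sum0.
apply: esym; apply: etrans sum0.
by apply: eq_bigr => l _; rewrite !mxE enum_rankK mulrC.
Qed.

(** Modulo [low M d], a matrix [C] expresses the first family through the second; a relation between
    its rows would be one between independent elements. *)
Lemma min_basis_rank_le M J1 J2 (g1 : J1 -> ncvec K m r) (g2 : J2 -> ncvec K m r)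
    deg1 deg2 d p q (s1 : 'I_p -> J1) (s2 : 'I_q -> J2) :
    hom_family delta g1 deg1 -> is_min_basis I M g1 ->
    hom_family delta g2 deg2 -> is_basis I M g2 ->
    injective s1 -> (forall k, deg1 (s1 k) = d) ->
    (forall k, deg2 k = d -> exists j, s2 j = k) ->
  (p <= q)%N.
Proof.
move=> hg1 mg1 hg2 bg2 inj1 d1 full2.
have /fin_all_exists[c /fin_all_exists[l hl]] : forall k : 'I_p,
    exists c : 'I_q -> K, exists l,
    low M d l /\ g1 (s1 k) = vadd l (vlin c (g2 \o s2)).
  move=> k; apply: (hom_expand hg2 bg2 full2); first exact: (basis_mem mg1.1).
  by rewrite -(d1 k); apply: hg1.
pose C := \matrix_(k < p, j < q) c k j.
suff /eqP <- : row_free C by apply: rank_leq_col.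
apply: inj_row_free => u uC0; apply/rowP => k; rewrite mxE.
apply: (min_basis_indep (c := fun k => u 0 k) hg1 mg1 inj1 d1 _ k).
(* The part along [g2] has the entries of [u *m C] as coefficients and vanishes; only the lower
   terms [l] remain. *)
rewrite (_ : vlin _ _ = vlin (fun k => u 0 k) l).
  by apply: (vlin_closed _ (low_submodule M d)) => j; case: (hl j).
apply: ncvec_ext => i w; rewrite !vlinE /=.
transitivity (\sum_j (l j i w * u 0 j + \sum_k (g2 (s2 k) i w * (u 0 j * c j k)))).
  apply: eq_bigr => j _; rewrite (hl j).2 /vadd /ncadd vlinE mulrDl mulr_suml.
  by congr (_ + _); apply: eq_bigr => x _ /=; rewrite -mulrA (mulrC (c j x)).
rewrite big_split exchange_big /= [X in _ + X]big1 ?addr0 // => x _.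
have /matrixP/(_ 0 x) := uC0; rewrite !mxE => sum0.
rewrite -mulr_sumr (_ : \sum_j _ = 0) ?mulr0 //; apply: etrans sum0.
by apply: eq_bigr => j _; rewrite mxE.
Qed.

End HomogeneousBasis.

(** * Finite enumerations and comparison of two minimal bases *)

Lemma complete_enumeration J (P : J -> Prop) B :
    (forall p (s : 'I_p -> J), injective s -> (forall k, P (s k)) -> (p <= B)%N) ->
  exists p (s : 'I_p -> J),
    [/\ injective s, forall k, P (s k) & forall j, P j -> exists k, s k = j].
Proof.
move=> bound; pose good p (s : 'I_p -> J) := injective s /\ forall k, P (s k).
(* [b] is fuel: each new element lengthens the enumeration by one and lowers [b] by one; at [b = 0]
   the length would exceed [B]. *)
suff ext b q : (B < b + q)%N -> (exists s : 'I_q -> J, good q s) ->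
    exists p (s : 'I_p -> J),
    [/\ injective s, forall k, P (s k) & forall j, P j -> exists k, s k = j].
  apply: (ext B.+1 0%N); first by lia.
  (* [J] may be empty, so the empty enumeration takes its values from the absurdity of ['I_0]. *)
  by exists (fun k : 'I_0 => False_rect J (notF (ltn_ord k))); split=> -[].
elim: b q => [|b IHb] p lt_B [s [inj_s Ps]].
  by have := bound _ _ inj_s Ps; lia.
have [full|] := classic (forall j, P j -> exists k, s k = j); first by exists p, s.
move=> /not_all_ex_not[j /(imply_to_and (P j))[Pj new_j]].
apply: (IHb p.+1); first by lia.
exists (fun k => if unlift ord0 k is Some l then s l else j); split=> [k1 k2|k].
  case: unliftP => [l1|] ->; case: unliftP => [l2|] -> //.
  - by move/inj_s->.
  - by move=> e; case: new_j; exists l1.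
  - by move=> e; case: new_j; exists l2.
by case: unliftP.
Qed.

Lemma enumeration_bij J (P : J -> Prop) p (s : 'I_p -> J) :
    injective s -> (forall k, P (s k)) -> (forall j, P j -> exists k, s k = j) ->
  exists f : 'I_p -> {j | P j}, bijective f.
Proof.
move=> inj_s Ps full.
pose inv (x : {j | P j}) := constructive_indefinite_description _ (full _ (proj2_sig x)).
exists (fun k => exist _ (s k) (Ps k)), (fun x => proj1_sig (inv x)) => [k|x].
  by apply: inj_s; apply: (proj2_sig (inv _)).
apply: eq_sig_hprop => [j|]; first exact: proof_irrelevance.
exact: (proj2_sig (inv x)).
Qed.

Lemma min_basis_degree_bij (K : fieldType) (m r : nat) (I : ncF K m -> Prop)
    (delta : 'I_r -> nat) (M : ncvec K m r -> Prop) (J1 J2 : Type)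
    (g1 : J1 -> ncvec K m r) (g2 : J2 -> ncvec K m r) deg1 deg2 d :
    graded_ideal I ->
    hom_family delta g1 deg1 -> is_min_basis I M g1 ->
    hom_family delta g2 deg2 -> is_min_basis I M g2 ->
  exists f : {j : J1 | deg1 j = d} -> {k : J2 | deg2 k = d}, bijective f.
Proof.
move=> idI h1 m1 h2 m2.
have [B1 /(complete_enumeration (P := fun j => deg1 j = d))[p [s1 [inj1 d1 full1]]]]
  := min_basis_bounded idI d h1 m1.
have [B2 /(complete_enumeration (P := fun j => deg2 j = d))[q [s2 [inj2 d2 full2]]]]
  := min_basis_bounded idI d h2 m2.
have eq_pq : p = q.
  apply/eqP; rewrite eqn_leq.
  rewrite (min_basis_rank_le idI h1 m1 h2 m2.1 inj1 d1 full2).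
  by rewrite (min_basis_rank_le idI h2 m2 h1 m1.1 inj2 d2 full1).
(* With a common index type, one enumeration composes with the inverse of the other. *)
case: q / eq_pq s2 inj2 d2 full2 => s2 inj2 d2 full2.
have [f1 [f1' f1K f1'K]] := enumeration_bij inj1 d1 full1.
have [f2 bij2] := enumeration_bij inj2 d2 full2.
by exists (f2 \o f1'); apply: bij_comp bij2 _; exists f1.
Qed.

Local Close Scope ring_scope.

Theorem mainTheorem2 (K : fieldType) (n r : nat) (I : ncF K n -> Prop)
  (delta delta' : 'I_r -> nat) (M : ncvec K n r -> Prop)
  (J : Type) (g : J -> ncvec K n r) (deg : J -> nat) :
  graded_ideal I ->
  (forall i, delta' i <= delta i) ->
  graded_submodule I delta M ->
  (forall j, M (g j)) -> hom_family delta g deg ->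
  (is_basis I M g <->
     is_basis (Ibar I) (Hmod I delta delta' M) (fun j => etaH delta delta' (g j)))
  /\ (is_min_basis I M g <->
     is_min_basis (Ibar I) (Hmod I delta delta' M) (fun j => etaH delta delta' (g j)))
  /\ (forall (d : nat) (J1 J2 : Type)
        (g1 : J1 -> ncvec K n r) (deg1 : J1 -> nat)
        (g2 : J2 -> ncvec K n.+1 r) (deg2 : J2 -> nat),
        is_min_basis I M g1 -> hom_family delta g1 deg1 ->
        is_min_basis (Ibar I) (Hmod I delta delta' M) g2 -> hom_family delta' g2 deg2 ->
        exists f : {j : J1 | deg1 j = d} -> {k : J2 | deg2 k = d}, bijective f).
Proof.
move=> idI le_delta modM gM _; split; first exact: is_basis_eta.
split=> [|d J1 J2 g1 deg1 g2 deg2 m1 h1 m2 h2]; first exact: is_min_basis_eta.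
(* [g2] is compared with the image of [g1] under [etaH], a minimal basis of the same module with the
   degrees of [g1]. *)
apply: min_basis_degree_bij (Ibar_graded idI) _ _ h2 m2 => [j|].
  exact: eta_hom (h1 j).
exact: (is_min_basis_eta idI delta' modM (basis_mem idI m1.1)).1.
Qed.
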